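(* Let $(G,o)$ be a Menger algebra of rank $n$ and let $H$ be a nonempty bistrong subset of $G$. Then each $\mathcal{P}_H$-class $X$ different from $W^H$ is bistrong, $W^H\subseteq W^X$, and $\mathcal{P}_H\subseteq\mathcal{P}_X$. Furthermore, the restrictions of $\mathcal{P}_H$ and $\mathcal{P}_X$ to $G\setminus W^X$ coincide, i.e. $\mathcal{P}_H\cap\big((G\setminus W^X)\times(G\setminus W^X)\big)=\mathcal{P}_X\cap\big((G\setminus W^X)\times(G\setminus W^X)\big)$.
   Context: Let $n$ be a positive integer. A Menger algebra $(G,o)$ of rank $n$ is a nonempty set $G$ with an $(n+1)$-ary operation $o:(f,g_1,\ldots,g_n)\mapsto f[g_1\ldots g_n]$ satisfying the superassociative law $f[g_1\ldots g_n][h_1\ldots h_n]=f[g_1[h_1\ldots h_n]\ldots g_n[h_1\ldots h_n]]$ for all $f,g_i,h_i\in G$. Put $B=G^n\cup\{\overline{e}\}$, where $\overline{e}=(e_1,\ldots,e_n)$ is a tuple of pairwise different formal symbols not in $G$. For $g\in G$ and $\overline{x}=(x_1,\ldots,x_n)\in G^n$ write $g[\overline{x}]=g[x_1\ldots x_n]$, and put $g[\overline{e}]=g$. $T_n(G)$ is the smallest set of polynomials in one variable $x$ such that $x\in T_n(G)$ and, whenever $i\in\{1,\ldots,n\}$, $a,b_1,\ldots,b_{i-1},b_{i+1},\ldots,b_n\in G$ and $t\in T_n(G)$, also $a[b_1\ldots b_{i-1}\,t\,b_{i+1}\ldots b_n]\in T_n(G)$. Each $t\in T_n(G)$ is identified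 with the map $G\to G$, $x\mapsto t(x)$, it defines. For a subset $K\subseteq G$ and $g\in G$ put $\sigma_K\langle g\rangle=\{(\overline{x},t)\in B\times T_n(G)\mid t(g[\overline{x}])\in K\}$, $W^K=\{g\in G\mid\sigma_K\langle g\rangle=\varnothing\}$, and $\mathcal{P}_K=\{(g_1,g_2)\in G\times G\mid\sigma_K\langle g_1\rangle=\sigma_K\langle g_2\rangle\}$ (an equivalence relation). A $\mathcal{P}_K$-class is an equivalence class of $\mathcal{P}_K$. The subset $K$ is called bistrong if for all $a,b\in G$, $\sigma_K\langle a\rangle\cap\sigma_K\langle b\rangle\neq\varnothing$ implies $\sigma_K\langle a\rangle=\sigma_K\langle b\rangle$. *)

(* Defs.v *)
From mathcomp Require Import all_boot classical_sets.

Set Implicit Arguments.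
Unset Strict Implicit.
Unset Printing Implicit Defensive.

Local Open Scope classical_set_scope.

(* [superpos f g] is f[g_1 ... g_n]. *)
Record mengerAlgebra (n : nat) := MengerAlgebra {
  carrier :> Type;
  superpos : carrier -> n.-tuple carrier -> carrier;
  carrier_inhabited : inhabited carrier;
  superassoc : forall (f : carrier) (g h : n.-tuple carrier),
    superpos (superpos f g) h
    = superpos f [tuple superpos (tnth g i) h | i < n]
}.

Section Menger.
Variables (n : nat) (G : mengerAlgebra n).

(* B = G^n together with the tuple of selectors, the latter being [None]. *)
Definition argB : Type := option (n.-tuple G).

Definition appB (g : G) (x : argB) : G :=
  if x is Some y then superpos g y else g.

(* T_n(G), polynomials being identified with the maps they define.
   The i-th entry of [b] is discarded: it is overwritten by [t x]. *)
Inductive translation : (G -> G) -> Prop :=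
| translation_id : translation (fun x => x)
| translation_superpos (i : 'I_n) (a : G) (b : n.-tuple G) (t : G -> G) :
    translation t ->
    translation (fun x =>
      superpos a [tuple if j == i then t x else tnth b j | j < n]).

Definition sigma (K : set G) (g : G) : set (argB * (G -> G)) :=
  [set p | translation p.2 /\ K (p.2 (appB g p.1))].

Definition W (K : set G) : set G := [set g | sigma K g = set0].

Definition Prel (K : set G) : set (G * G) :=
  [set p | sigma K p.1 = sigma K p.2].

Definition is_Pclass (K X : set G) : Prop :=
  exists g : G, X = [set g' | Prel K (g, g')].

Definition bistrong (K : set G) : Prop :=
  forall a b : G, sigma K a `&` sigma K b !=set0 -> sigma K a = sigma K b.

End Menger.

(* Main.v *)
Require Import Defs.
From mathcomp Require Import all_boot classical_sets.
Local Open Scope classical_set_scope.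

(** Since [X] is not [W H], its elements [g] share a pair [(y, s)] with
    [s (g[y])] in [H], and bistrength of [H] turns this into
    [X = {g | s (g[y]) \in H}].  By superassociativity,
    [s (t (g[x])[y]) = (s o t') (g[x[y]])], where the translation [t'] is [t]
    with [y] substituted in its coefficients.  So membership in [sigma X g] of
    each pair amounts to membership in [sigma H g] of another pair that does not
    depend on [g]. *)

Section Translations.
Set Implicit Arguments.
Unset Strict Implicit.
Variables (n : nat) (G : mengerAlgebra n).
Implicit Types (x y : argB G) (s t : G -> G).

Lemma translation_comp s t :
  translation s -> translation t -> translation (s \o t).
Proof.
by move=> + Tt; elim=> [//|i a b s' _ IHs]; exact: translation_superpos IHs.
Qed.

(** Two substitutions merge into one: [None] is neutral on either side, and superassociativity
    combines two proper tuples. *)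
Lemma appB_appB x y : exists z, forall g : G, appB (appB g x) y = appB g z.
Proof.
case: x => [u|]; last by exists y.
case: y => [v|]; last by exists (Some u).
by exists (Some [tuple superpos (tnth u i) v | i < n]) => g; exact: superassoc.
Qed.

Lemma appB_translation t y : translation t ->
  exists2 t', translation t' & forall g : G, appB (t g) y = t' (appB g y).
Proof.
case: y => [v|]; last by exists t.
elim=> [|i a b s _ [s' Ts' ss']]; first by exists id => //; exact: translation_id.
(* Substituting [v] in the whole of [b] is harmless at [i], where [s' g] overwrites the entry. *)
exists (fun g => superpos a [tuple if j == i then s' g
    else tnth [tuple superpos (tnth b k) v | k < n] j | j < n]).
  exact: translation_superpos.
move=> g /=; rewrite superassoc; congr superpos.
apply: eq_mktuple => j; rewrite !tnth_mktuple.
by case: ifP => // _; exact: ss'.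
Qed.

Lemma Pclass_preimage (H X : set G) : bistrong H -> is_Pclass H X -> X <> W H ->
  exists y, exists2 s, translation s & X = [set g | H (s (appB g y))].
Proof.
move=> H_bistrong [g0 ->] neqW.
have [g0_empty|/set0P[[y s] [/= Ts Hs]]] := eqVneq (sigma H g0) set0.
  (* If [sigma H g0] is empty, the class of [g0] is [W H] itself, which is excluded. *)
  case: neqW; apply/seteqP; split=> g; rewrite /W /Prel /= g0_empty.
    by move=> <-.
  by move=> ->.
exists y, s => //; apply/seteqP; split=> g; rewrite /Prel /=.
  move=> Pg; have : sigma H g0 (y, s) by [].
  by rewrite Pg => -[].
by move=> Hg; apply: H_bistrong; exists (y, s).
Qed.

Lemma sigma_Pclass (H X : set G) : bistrong H -> is_Pclass H X -> X <> W H ->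
  forall p, translation p.2 -> exists q, forall g, sigma X g p <-> sigma H g q.
Proof.
move=> H_bistrong X_class /(Pclass_preimage H_bistrong X_class)[y [s Ts ->]].
move=> [x t] /= Tt; have [t' Tt' tt'] := appB_translation y Tt.
have [z xy] := appB_appB x y.
exists (z, s \o t') => g; rewrite /sigma /= tt' xy.
by split=> -[_ Hg]; split=> //; exact: translation_comp.
Qed.

End Translations.

Theorem theorem4p8 (n : nat) (n_gt0 : (0 < n)%N) (G : mengerAlgebra n)
    (H : set G) (H_neq0 : H !=set0) (H_bistrong : bistrong H)
    (X : set G) (X_class : is_Pclass H X) (X_neq_W : X <> W H) :
  [/\ bistrong X,
      W H `<=` W X,
      Prel H `<=` Prel X &
      Prel H `&` (~` W X `*` ~` W X) = Prel X `&` (~` W X `*` ~` W X)].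
Proof.
have sigmaP := sigma_Pclass H_bistrong X_class X_neq_W.
have incl a b : sigma H a = sigma H b -> sigma X a `<=` sigma X b.
  move=> Pab p Xp; have [q Sq] := sigmaP p (proj1 Xp).
  by apply/Sq; rewrite -Pab; apply/Sq.
have sub : Prel H `<=` Prel X.
  by move=> [a b] Pab; apply/seteqP; split; apply: incl.
(* One [q] serves both [a] and [b], so bistrength of [H] applies. Concluding on [sigma H] yields
   bistrength of [X] through [sub], and also the reverse inclusion of the last claim. *)
have meet a b : sigma X a `&` sigma X b !=set0 -> sigma H a = sigma H b.
  move=> [p [Xa Xb]]; have [q Sq] := sigmaP p (proj1 Xa).
  by apply: H_bistrong; exists q; split; apply/Sq.
split=> //.
- by move=> a b /meet Pab; exact: (sub (a, b)).
- move=> g Wg; apply/eqP/negPn/negP => /set0P[p Xp].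
  have [q Sq] := sigmaP p (proj1 Xp).
  by have /Sq := Xp; rewrite Wg.
- apply/seteqP; split=> -[a b] [Pab Wab]; split=> //; first exact: sub.
  (* Outside [W X], [sigma X a] contains some [p], and [Pab] puts [p] in [sigma X b] as well. *)
  have [Wa _] := Wab; move/eqP/set0P: Wa => [p Xp].
  by apply: meet; exists p; split=> //; rewrite -[sigma X b]Pab.
Qed.
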